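(* Let $\widetilde{\mathcal Z}$ be a Euclidean zero-set with finite area. Then for all $\alpha\in[0,1]$, $$\widetilde\gamma_{\rm thin}(\widetilde{\mathcal Z})\big((1-\alpha)-2(1-\alpha)^2\big)\le\widetilde I(\alpha,\alpha,\widetilde{\mathcal Z})\le\widetilde\gamma_{\rm thin}(\widetilde{\mathcal Z})(1-\alpha).$$ Furthermore, $\widetilde I(\alpha,\alpha,\widetilde{\mathcal Z})=(1-\alpha)\widetilde\gamma(\widetilde{\mathcal Z})$ for all $\alpha\in[0,1]$ if and only if $\widetilde\gamma_{\rm thin}(\widetilde{\mathcal Z})=\widetilde\gamma(\widetilde{\mathcal Z})$.
   Context: $\widetilde R_{a,b}=[0,a]\times[0,b]$. A Euclidean zero-set is a closed $\widetilde{\mathcal Z}\subseteq[0,\infty)^2$ such that $(a,b)\in\widetilde{\mathcal Z}$ implies $\widetilde R_{a,b}\subseteq\widetilde{\mathcal Z}$, and $\widetilde{\mathcal Z}$ is the closure of $\widetilde{\mathcal Z}\cap(0,\infty)^2$. For Borel $A\subseteq[0,\infty)^2$, $\widetilde{\mathrm{row}}(x,A)$ (resp. $\widetilde{\mathrm{col}}(x,A)$) is the 1-dimensional Lebesgue measure of $A$ intersected with the horizontal (resp. vertical) line through $x$. For left-continuous nonincreasing $f,g:[0,\infty)\to[0,\infty)$ of compact support, $\widetilde{\mathcal T}(A)=A\cup\{(u,v):(\widetilde{\mathrm{row}}((u,v),A)+f(v),\widetilde{\mathrm{col}}((u,v),A)+g(u))\notin\widetilde{\mathcal Z}\}$; $A$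 E-spans for $(\widetilde{\mathcal Z},f,g)$ if $\bigcup_n\widetilde{\mathcal T}^n(A)=[0,\infty)^2$. For bounded $\widetilde{\mathcal Z}$ and $(\alpha,\beta)\in[0,1]^2$: $\widetilde I(\alpha,\beta,\widetilde{\mathcal Z})=\inf\{\mathrm{area}(A)+(1-\alpha)\int_0^\infty f+(1-\beta)\int_0^\infty g\}$ over all $(A,f,g)$ with $A$ compact E-spanning for $(\widetilde{\mathcal Z},f,g)$; $\widetilde\gamma_{\rm thin}(\widetilde{\mathcal Z})=\inf\{\int f+\int g:\emptyset\text{ E-spans for }(\widetilde{\mathcal Z},f,g)\}$. For general $\widetilde{\mathcal Z}$ both are defined as $\lim_{R\to\infty}$ of the values for $\widetilde{\mathcal Z}\cap[0,R]^2$. $\widetilde\gamma(\widetilde{\mathcal Z})=\widetilde I(0,0,\widetilde{\mathcal Z})$. *)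

(* Defs.v *)
From HB Require Import structures.
From mathcomp Require Import all_boot all_order all_algebra.
From mathcomp Require Import all_classical all_reals all_analysis.
Set Implicit Arguments. Unset Strict Implicit. Unset Printing Implicit Defensive.
Import Order.TTheory GRing.Theory Num.Theory.
Import numFieldNormedType.Exports.
Local Open Scope classical_set_scope.
Local Open Scope ring_scope.

Section Defs.
Variable R : realType.

Definition quadrant : set (R * R) := [set p | 0 <= p.1 /\ 0 <= p.2].
Definition open_quadrant : set (R * R) := [set p | 0 < p.1 /\ 0 < p.2].

Definition rect (a b : R) : set (R * R) :=
  [set p | 0 <= p.1 <= a /\ 0 <= p.2 <= b].

Definition euclidean_zero_set (Z : set (R * R)) : Prop :=
  [/\ closed Z, Z `<=` quadrant,
      (forall a b, Z (a, b) -> rect a b `<=` Z) &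
      Z = closure (Z `&` open_quadrant)].

Definition area (A : set (R * R)) : \bar R :=
  ((@lebesgue_measure R) \x (@lebesgue_measure R))%E A.

Definition row (p : R * R) (A : set (R * R)) : \bar R :=
  (@lebesgue_measure R) [set x : R | A (x, p.2)].
Definition col (p : R * R) (A : set (R * R)) : \bar R :=
  (@lebesgue_measure R) [set y : R | A (p.1, y)].

(* membership of a pair of extended reals in Z; infinite coordinates are never in Z *)
Definition inZ (Z : set (R * R)) (a b : \bar R) : Prop :=
  exists x y : R, [/\ a = x%:E, b = y%:E & Z (x, y)].

(* admissible f, g : [0,oo) -> [0,oo), left-continuous, nonincreasing,
   compact support (only values on [0,oo) matter) *)
Definition admissible (f : R -> R) : Prop :=
  [/\ (forall x, 0 <= x -> 0 <= f x),
      (forall x y, 0 <= x -> x <= y -> f y <= f x),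
      (forall x, 0 < x -> (f @ x^'-) --> f x) &
      (exists M, forall x, M <= x -> f x = 0)].

Definition T_op (Z : set (R * R)) (f g : R -> R) (A : set (R * R)) :
    set (R * R) :=
  A `|` [set p | quadrant p /\
           ~ inZ Z (row p A + (f p.2)%:E)%E (col p A + (g p.1)%:E)%E].

Definition E_spans (Z : set (R * R)) (f g : R -> R) (A : set (R * R)) :
    Prop :=
  \bigcup_(n in [set: nat]) iter n (T_op Z f g) A = quadrant.

Definition int0oo (f : R -> R) : \bar R :=
  (\int[@lebesgue_measure R]_(x in `[0%R, +oo[) (f x)%:E)%E.

Definition I_bdd (alpha beta : R) (Z : set (R * R)) : \bar R :=
  ereal_inf [set c | exists A f g,
    [/\ compact A /\ (A `<=` quadrant), admissible f, admissible g,
        E_spans Z f g A &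
        c = (area A + (1 - alpha)%:E * int0oo f + (1 - beta)%:E * int0oo g)%E]].

Definition gamma_thin_bdd (Z : set (R * R)) : \bar R :=
  ereal_inf [set c | exists f g,
    [/\ admissible f, admissible g, E_spans Z f g set0 &
        c = (int0oo f + int0oo g)%E]].

(* general Z: limit as Rad -> oo of the values for Z ∩ [0,Rad]^2
   (for bounded Z this agrees with the bounded definition) *)
Definition I_tilde (alpha beta : R) (Z : set (R * R)) : \bar R :=
  lim (I_bdd alpha beta (Z `&` rect r r) @[r --> +oo]).

Definition gamma_thin (Z : set (R * R)) : \bar R :=
  lim (gamma_thin_bdd (Z `&` rect r r) @[r --> +oo]).

Definition gamma_tilde (Z : set (R * R)) : \bar R := I_tilde 0 0 Z.

End Defs.

(* Main.v *)
Require Import Defs.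
From HB Require Import structures.
From mathcomp Require Import all_boot all_order all_algebra.
From mathcomp Require Import all_classical all_reals all_analysis.
From mathcomp Require Import measurable_realfun lra.
Import Order.TTheory GRing.Theory Num.Theory.
Import numFieldNormedType.Exports.
Local Open Scope classical_set_scope.
Local Open Scope ring_scope.

(** A compact set [A] that E-spans with enhancements [f], [g] can be traded for
    the enhancements [h v := row v A + f v] and [k u := col u A + g u] started
    from the empty set, at the cost of counting the area of [A] twice.  Whether
    [(u, v)] is occupied at time [n] of the traded dynamics depends only on the
    pair [(h v, k u)], through an up-set whose evolution involves [h] and [k]
    only via the measures of their superlevel sets.  Hence [h] and [k] may be
    replaced by left-continuous nonincreasing step functions that dominate them
    in distribution and have almost the same integral, which gives
    [gamma_thin <= 2 * area A + int f + int g].  Multiplying by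
    [1 - alpha <= 1/2] bounds [(1 - alpha) * gamma_thin] by the cost of
    [(A, f, g)]; this is stronger than the lower bound of the theorem and, taken
    at [alpha = 1/2], yields the equality criterion. *)

Set Implicit Arguments. Unset Strict Implicit. Unset Printing Implicit Defensive.

Local Notation row := Defs.row.
Local Notation col := Defs.col.

(** * Monotonicity of the dynamics *)

Definition down_closed (R : realType) (Z : set (R * R)) :=
  forall a b, Z (a, b) -> rect a b `<=` Z.

(** [lebesgue_measure] comes from an outer measure, monotone on arbitrary sets, so slices of
    iterates can be compared without proving them measurable. *)
Lemma le_lebesgue (R : realType) (A B : set R) :
  A `<=` B -> (@lebesgue_measure R A <= @lebesgue_measure R B)%E.
Proof. exact: (le_outer_measure (@lebesgue_measure R)). Qed.

Lemma inZ_le (R : realType) (Z : set (R * R)) (a b a' b' : \bar R) :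
  down_closed Z -> (0 <= a' <= a)%E -> (0 <= b' <= b)%E ->
  inZ Z a b -> inZ Z a' b'.
Proof.
move=> dZ /andP[a'0 a'a] /andP[b'0 b'b] [x [y [ax bx Zxy]]].
move: a' b' a'0 a'a b'0 b'b => [x'| |] [y'| |]; rewrite ax bx ?leye_eq//=.
rewrite !lee_fin => x'0 x'x y'0 y'y; exists x', y'; split=> //.
by apply: dZ Zxy _ _; split=> /=; apply/andP.
Qed.

Lemma down_closedI_rect (R : realType) (Z : set (R * R)) (r : R) :
  down_closed Z -> down_closed (Z `&` rect r r).
Proof.
move=> dZ a b [Zab [/= /andP[a0 ar] /andP[b0 br]]] p pab; split.
  exact: (dZ _ _ Zab).
case: pab => /andP[p0 pa] /andP[q0 qb].
by split; apply/andP; split=> //; [exact: le_trans ar|exact: le_trans br].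
Qed.

Lemma row_ge0 (R : realType) (p : R * R) A : (0 <= row p A)%E.
Proof. exact: measure_ge0. Qed.

Lemma col_ge0 (R : realType) (p : R * R) A : (0 <= col p A)%E.
Proof. exact: measure_ge0. Qed.

(** Enlarging the set raises row and column measures, and the complement of a down-closed set is an
    up-set among nonnegative pairs. *)
Lemma T_op_le (R : realType) (Z Z' : set (R * R)) f g A A' :
  admissible f -> admissible g -> down_closed Z' -> Z `<=` Z' -> A' `<=` A ->
  T_op Z' f g A' `<=` T_op Z f g A.
Proof.
move=> [f0 _ _ _] [g0 _ _ _] dZ' ZZ' A'A p [/A'A|[qp nZ]]; first by left.
right; split=> // -[x [y [ex ey Zxy]]]; apply: nZ.
have /= [p10 p20] := qp.
apply: (@inZ_le _ _ x%:E y%:E) => //; last by exists x, y; split=> //; exact: ZZ'.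
- rewrite adde_ge0 ?row_ge0 ?lee_fin ?f0//= -ex leeD2r//.
  by apply: le_lebesgue => z /A'A.
- rewrite adde_ge0 ?col_ge0 ?lee_fin ?g0//= -ey leeD2r//.
  by apply: le_lebesgue => z /A'A.
Qed.

Lemma iter_T_op_quadrant (R : realType) (Z : set (R * R)) f g A n :
  A `<=` @quadrant R -> iter n (T_op Z f g) A `<=` @quadrant R.
Proof. by move=> Aq; elim: n => //= n IH p [/IH//|[]]. Qed.

Lemma E_spans_le (R : realType) (Z Z' : set (R * R)) f g A :
  admissible f -> admissible g -> down_closed Z' -> Z `<=` Z' ->
  A `<=` @quadrant R -> E_spans Z' f g A -> E_spans Z f g A.
Proof.
move=> af ag dZ' ZZ' Aq spA; apply/seteqP; split.
  by move=> p [n _]; exact: iter_T_op_quadrant.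
rewrite -spA => p [n _ np]; exists n => //; elim: n p np => //= n IH p.
exact: T_op_le.
Qed.

(** * The dynamics on pairs of heights *)

Definition nneg_measure (R : realType) (P : R -> Prop) : \bar R :=
  lebesgue_measure [set x | 0 <= x /\ P x].

Lemma nneg_measure_ge0 (R : realType) (P : R -> Prop) : (0 <= nneg_measure P)%E.
Proof. exact: measure_ge0. Qed.

(* [heights Z h k n (h v, k u)] says that [(u, v)] is occupied after [n] steps of
   the dynamics enhanced by [h] and [k] and started from the empty set. *)
Fixpoint heights (R : realType) (Z : set (R * R)) (h k : R -> R) (n : nat) :
    set (R * R) :=
  if n is m.+1 then heights Z h k m `|` [set st | ~ inZ Z
    (nneg_measure (fun u => heights Z h k m (st.1, k u)) + st.1%:E)%E
    (nneg_measure (fun v => heights Z h k m (h v, st.2)) + st.2%:E)%E]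
  else set0.

(** Raising [s] raises the first sum directly and, by induction, enlarges the slices in both sums;
    likewise for [t]. Hence slices of [heights] are up-sets, to which [dominates] applies. *)
Lemma heights_up (R : realType) (Z : set (R * R)) h k n s t s' t' :
  down_closed Z -> (forall x, 0 <= x -> 0 <= h x) ->
  (forall x, 0 <= x -> 0 <= k x) ->
  0 <= s <= s' -> 0 <= t <= t' ->
  heights Z h k n (s, t) -> heights Z h k n (s', t').
Proof.
move=> dZ h0 k0; elim: n s t s' t' => //= n IH s t s' t' ss' tt'.
move=> [H|H]; [by left; exact: IH H|right=> H'; apply: H; apply: inZ_le H' => //=].
- case/andP: ss' => s0 ss'; rewrite adde_ge0 ?nneg_measure_ge0 ?lee_fin//= leeD ?lee_fin//.
  apply: le_lebesgue => u [u0 H]; split=> //; apply: IH H; first exact/andP.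
  by rewrite lexx k0.
- case/andP: tt' => t0 tt'; rewrite adde_ge0 ?nneg_measure_ge0 ?lee_fin//= leeD ?lee_fin//.
  apply: le_lebesgue => u [u0 H]; split=> //; apply: IH H; last exact/andP.
  by rewrite lexx h0.
Qed.

(* Subadditivity of the outer measure lets the contribution of [A] to the rows
   and columns be charged once and for all to [h] and [k]. *)
Lemma iter_T_op_heights (R : realType) (Z : set (R * R)) f g h k A n p :
  down_closed Z -> A `<=` @quadrant R ->
  (forall x, 0 <= x -> 0 <= f x) -> (forall x, 0 <= x -> 0 <= g x) ->
  (forall u v, 0 <= v -> (row (u, v) A + (f v)%:E)%E = (h v)%:E) ->
  (forall u v, 0 <= u -> (col (u, v) A + (g u)%:E)%E = (k u)%:E) ->
  iter n (T_op Z f g) A p -> ~ A p -> heights Z h k n (h p.2, k p.1).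
Proof.
move=> dZ Aq f0 g0 hE kE.
elim: n p => [p //|n IH [u v]] /= [Ap nAp|[[/= u0 v0] nZ] nAp].
  by left; exact: (IH (u, v)).
right=> H; apply: nZ; apply: inZ_le H => //.
- rewrite adde_ge0 ?row_ge0 ?lee_fin ?f0//= -(hE u)// addeA leeD2r//.
  apply: le_trans (outer_measureU2 (@lebesgue_measure R) _ _).
  apply: le_lebesgue => x /= xA; have [Ax|nAx] := pselect (A (x, v)); first by right.
  by left; split; [have [] := iter_T_op_quadrant Aq xA|exact: (IH (x, v))].
- rewrite adde_ge0 ?col_ge0 ?lee_fin ?g0//= -(kE _ v)// addeA leeD2r//.
  apply: le_trans (outer_measureU2 (@lebesgue_measure R) _ _).
  apply: le_lebesgue => x /= xA; have [Ax|nAx] := pselect (A (u, x)); first by right.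
  by left; split; [have [] := iter_T_op_quadrant Aq xA|exact: (IH (u, x))].
Qed.

(** Stochastic domination. Quantifying over up-sets covers open and closed half-lines alike and lets
    slices of [heights] be plugged in directly. *)
Definition dominates (R : realType) (h' h : R -> R) :=
  forall U : set R, (forall s t, 0 <= s <= t -> U s -> U t) ->
  (nneg_measure (U \o h) <= nneg_measure (U \o h'))%E.

(** Each step of [heights] sees [h] and [k] only through measures of preimages of up-sets, and these
    can only grow when passing to [h'] and [k']. *)
Lemma heights_iter_T_op (R : realType) (Z : set (R * R)) h k h' k' n p :
  down_closed Z ->
  (forall x, 0 <= x -> 0 <= h x) -> (forall x, 0 <= x -> 0 <= k x) ->
  (forall x, 0 <= x -> 0 <= h' x) -> (forall x, 0 <= x -> 0 <= k' x) ->
  dominates h' h -> dominates k' k -> quadrant p ->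
  heights Z h k n (h' p.2, k' p.1) -> iter n (T_op Z h' k') set0 p.
Proof.
move=> dZ h0 k0 h'0 k'0 hh' kk'.
elim: n p => //= n IH [u v] [/= u0 v0] [H|H]; first by left; exact: (IH (u, v)).
right; split=> // H'; apply: H; apply: inZ_le H' => //=.
- rewrite adde_ge0 ?nneg_measure_ge0 ?lee_fin ?h'0//= leeD2r//.
  apply: le_trans (_ : (_ <= nneg_measure (fun x =>
      heights Z h k n (h' v, k' x)))%E) _.
    apply: (kk' [set t | heights Z h k n (h' v, t)]) => s t st.
    by apply: heights_up => //; rewrite h'0//=.
  by apply: le_lebesgue => x [x0 Hx]; exact: (IH (x, v)).
- rewrite adde_ge0 ?nneg_measure_ge0 ?lee_fin ?k'0//= leeD2r//.
  apply: le_trans (_ : (_ <= nneg_measure (fun x =>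
      heights Z h k n (h' x, k' u)))%E) _.
    apply: (hh' [set t | heights Z h k n (t, k' u)]) => s t st.
    by apply: heights_up => //; rewrite k'0//=.
  by apply: le_lebesgue => x [x0 Hx]; exact: (IH (u, x)).
Qed.

(** The point [p] is occupied at some time [n] and has heights [(0, 0)], the least pair. The up-set
    at time [n] then contains all nonnegative pairs, so the new dynamics fills the quadrant by that
    same time. *)
Lemma E_spans_rearrange (R : realType) (Z : set (R * R)) f g h k h' k' A
    (p : R * R) :
  down_closed Z -> A `<=` @quadrant R -> E_spans Z f g A ->
  (forall x, 0 <= x -> 0 <= f x) -> (forall x, 0 <= x -> 0 <= g x) ->
  (forall u v, 0 <= v -> (row (u, v) A + (f v)%:E)%E = (h v)%:E) ->
  (forall u v, 0 <= u -> (col (u, v) A + (g u)%:E)%E = (k u)%:E) ->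
  (forall x, 0 <= x -> 0 <= h' x) -> (forall x, 0 <= x -> 0 <= k' x) ->
  dominates h' h -> dominates k' k ->
  quadrant p -> ~ A p -> h p.2 = 0 -> k p.1 = 0 ->
  E_spans Z h' k' set0.
Proof.
move=> dZ Aq spA f0 g0 hE kE h'0 k'0 hh' kk' qp nAp hp kp.
have h0 x : 0 <= x -> 0 <= h x.
  by move=> x0; rewrite -lee_fin -(hE 0)// adde_ge0 ?row_ge0 ?lee_fin ?f0.
have k0 x : 0 <= x -> 0 <= k x.
  by move=> x0; rewrite -lee_fin -(kE _ 0)// adde_ge0 ?col_ge0 ?lee_fin ?g0.
have [n _ np] : (\bigcup_(n in [set: nat]) iter n (T_op Z f g) A) p.
  by rewrite [X in X p]spA.
have := iter_T_op_heights dZ Aq f0 g0 hE kE np nAp; rewrite hp kp => H0.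
apply/seteqP; split; first by move=> q [m _]; exact: iter_T_op_quadrant.
move=> [u v] [/= u0 v0]; exists n => //.
apply: (heights_iter_T_op dZ h0 k0) => //=.
by apply: heights_up H0; rewrite ?lexx ?h'0 ?k'0.
Qed.

(** * Staircases and decreasing rearrangement *)

Definition staircase (R : realType) (eta : R) (d : nat -> R) (K : nat) (x : R) :=
  \sum_(j < K) eta * (x <= d j)%R%:R.

Lemma staircase_admissible (R : realType) (eta M : R) d K :
  0 <= eta -> (forall j, d j <= M) -> admissible (staircase eta d K).
Proof.
move=> eta0 dM; split.
- by move=> x _; apply: sumr_ge0 => j _; rewrite mulr_ge0.
- move=> x y _ xy; apply: ler_sum => j _; rewrite ler_wpM2l// ler_nat.
  by have [/(le_trans xy)->|] := leP y (d j).
- move=> x _; rewrite /staircase; elim: K => [|K IH].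
    under eq_fun do rewrite big_ord0; rewrite big_ord0; exact: cvg_cst.
  under eq_fun do rewrite big_ord_recr/=; rewrite big_ord_recr/=.
  apply: cvgD => //; apply: cvg_near_cst.
  (* Layers are closed on the right, so each is constant just to the left of [x], even when
     [x = d K]. *)
  have [xd|dx] := leP x (d K); near=> y.
    by rewrite (le_trans _ xd)//; near: y; exact: nbhs_left_le.
  by rewrite leNgt (_ : d K < y)//; near: y; exact: nbhs_left_gt.
(* At [x = M] a layer with [d j = M] is still present, hence the shift by 1. *)
- exists (M + 1) => x Mx; rewrite /staircase big1// => j _.
  by rewrite leNgt (le_lt_trans (dM j)) ?mulr0// (lt_le_trans _ Mx) ?ltrDl.
Unshelve. all: by end_near. Qed.

Lemma lebesgue_measure_itv0 (R : realType) (a : R) : 0 <= a ->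
  lebesgue_measure (`[0, a] : set R) = a%:E.
Proof.
move=> a0; rewrite lebesgue_measure_itv/= lte_fin; case: ltP => [_|a0'].
  by rewrite -EFinB subr0.
by congr EFin; apply/eqP; rewrite eq_le a0.
Qed.

Lemma int0oo_staircase (R : realType) (eta : R) d K :
  0 <= eta -> (forall j, 0 <= d j) ->
  int0oo (staircase eta d K) = (\sum_(j < K) eta * d j)%:E.
Proof.
move=> eta0 d0; rewrite /int0oo /staircase.
pose F (j : 'I_K) x : \bar R := (eta%:E * (\1_`]-oo, d j] x)%:E)%E.
transitivity (\int[@lebesgue_measure R]_(x in `[0%R, +oo[) \sum_(j < K) F j x)%E.
  apply: eq_integral => x _; rewrite -sumEFin; apply: eq_bigr => j _.
  rewrite /F EFinM indicE; congr (_ * (nat_of_bool _)%:R%:E)%E.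
  by apply/idP/idP; rewrite inE/= in_itv.
have mI j : measurable_fun (`[0%R, +oo[ : set R)
    (fun x => ((\1_`]-oo, d j] x)%:E : \bar R)).
  by apply: measurableT_comp => //; exact: measurable_indic.
rewrite (ge0_integral_sum (@lebesgue_measure R) (D := `[0%R, +oo[%classic) _ (f := F))//; last 2 first.
  by move=> j; apply: measurable_funeM; exact: mI.
  by move=> j x _; rewrite /F mule_ge0 ?lee_fin.
rewrite -sumEFin; apply: eq_bigr => j _; rewrite /F ge0_integralZl_EFin//; last first.
  exact: mI.
rewrite integral_indic// EFinM; congr (_ * _)%E.
rewrite -(lebesgue_measure_itv0 (d0 j)); congr lebesgue_measure.
by apply/seteqP; split=> x /=; rewrite !in_itv/= andbT; [case=> ->->|case/andP].
Qed.

(** A lower layer-cake sum: if the top threshold exceeds [t], its term vanishes; otherwise all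
    [K.+1] terms together are at most [K.+1%:R * eta <= t]. *)
Lemma lower_sum_le (R : realType) (eta t : R) K : 0 <= eta -> 0 <= t ->
  \sum_(j < K) eta * (j.+1%:R * eta <= t)%R%:R <= t.
Proof.
move=> eta0 t0; elim: K => [|K IH]; first by rewrite big_ord0.
have [Kt|tK] := leP (K.+1%:R * eta) t; last first.
  by rewrite big_ord_recr/= (lt_geF tK) mulr0 addr0.
apply: le_trans Kt; rewrite mulr_natl.
rewrite (_ : eta *+ K.+1 = \sum_(j < K.+1) eta); last by rewrite sumr_const card_ord.
by apply: ler_sum => j _; rewrite ler_piMr// lern1 leq_b1.
Qed.

(* [d j] is the measure of the superlevel set of [h] at height [j * eta], so the
   staircase approximates the decreasing rearrangement of [h] from above. *)
Lemma dominating_staircase (R : realType) (h : R -> R) (M N e : R) :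
  0 < e -> 0 <= M ->
  measurable_fun (`[0, +oo[ : set R) h ->
  (forall x, 0 <= x -> 0 <= h x <= N) -> (forall x, M < x -> h x = 0) ->
  exists h', [/\ admissible h', dominates h' h &
    (int0oo h' <= int0oo h + e%:E)%E].
Proof.
move=> e0 M0 mh h0N hM.
have h0 x : 0 <= x -> 0 <= h x by move=> /h0N/andP[].
have N0 : 0 <= N by have /andP[] := h0N 0 (lexx 0); exact: le_trans.
(* The only excess over [h] is the bottom layer, of cost at most [eta * M <= e]; the 1 keeps the
   denominator positive when [M = 0]. *)
pose eta := e / (M + 1).
have eta0 : 0 < eta by rewrite divr_gt0// ltr_wpDl.
pose D j := `[0, M]%classic `&` [set x | j%:R * eta <= h x].
pose K := (Num.truncn (N / eta)).+1.
have NK : N < K%:R * eta.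
  by rewrite -ltr_pdivrMr//; have /andP[] := truncn_itv (divr_ge0 N0 (ltW eta0)).
have mD j : measurable (D j).
  rewrite (_ : D j = `[0, M]%classic `&` (`[0, +oo[ `&` h @^-1` `[j%:R * eta, +oo[)).
    by apply: measurableI => //; apply: mh.
  apply/seteqP; split=> x; rewrite /D/= !in_itv/= !andbT; last by case=> ? [].
  by case=> /andP[-> ->] ->.
have muD j : (lebesgue_measure (D j) <= M%:E)%E.
  apply: (@le_trans _ _ (lebesgue_measure (`[0, M] : set R))).
    by apply: le_lebesgue; exact: subIsetl.
  by rewrite lebesgue_measure_itv0.
have finD j : lebesgue_measure (D j) \is a fin_num.
  by rewrite ge0_fin_numE//; exact: le_lt_trans (muD j) (ltry _).
pose d j := fine (lebesgue_measure (D j)).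
have d0 j : 0 <= d j by rewrite fine_ge0.
have dE j : (d j)%:E = lebesgue_measure (D j) by rewrite fineK.
have dM j : d j <= M by rewrite -lee_fin dE.
have d_ni i j : (i <= j)%N -> d j <= d i.
  move=> ij; rewrite -lee_fin !dE; apply: le_lebesgue => x [? /= jx]; split=> //=.
  by apply: le_trans jx; rewrite ler_wpM2r ?ler_nat// ltW.
exists (staircase eta d K); split.
- by apply: (staircase_admissible (M := M)) => //; exact: ltW.
- move=> U Uup; have f0 x : 0 <= staircase eta d K x.
    by apply: sumr_ge0 => j _; rewrite mulr_ge0// ltW.
  (* If [U 0], then [U] holds at every nonnegative value. Otherwise [U \o h] fails beyond [M], where
     [h] vanishes. *)
  have [U0|nU0] := pselect (U 0).
    by apply: le_lebesgue => x [x0 _]; split=> //=; apply: (Uup 0); rewrite ?lexx ?f0.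
  pose S := [set x | 0 <= x /\ U (h x)].
  change (lebesgue_measure S <= nneg_measure (U \o staircase eta d K))%E.
  have [->|/set0P[x1 Sx1]] := eqVneq S set0.
    by rewrite measure0 nneg_measure_ge0.
  (* Let [J] be the least cell index over [S], attained at [x2]. Then [S] lies in [D J], of measure
     [d J], while on [[0, d J]] the layers 0 to [J] are all present, so the staircase is at least
     [J.+1%:R * eta > h x2] and lies in [U]. *)
  pose q x := Num.truncn (h x / eta).
  have [J Jmin [x2 Sx2 qx2]] : exists2 J, (forall x, S x -> (J <= q x)%N) &
      exists2 x, S x & q x = J.
    have ex : exists n, `[< exists2 x, S x & q x = n >].
      by exists (q x1); apply/asboolP; exists x1.
    case: (ex_minnP ex) => J /asboolP ? Jmin; exists J => // x Sx.
    by apply: Jmin; apply/asboolP; exists x.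
  have SD : S `<=` D J.
    move=> x Sx; have [x0 Ux] := Sx; split.
      rewrite /= in_itv/= x0/= leNgt; apply/negP => /hM hx0.
      by apply: nU0; rewrite -hx0.
    by rewrite /= -ler_pdivlMr// -truncn_ge_nat ?Jmin// divr_ge0 ?h0// ltW.
  apply: (le_trans (le_lebesgue SD)); rewrite -dE -(lebesgue_measure_itv0 (d0 J)).
  apply: le_lebesgue => x /=; rewrite in_itv/= => /andP[x0 xd]; split=> //=.
  have [x20 Ux2] := Sx2; apply: Uup Ux2; rewrite h0//=.
  have /andP[_] := truncn_itv (divr_ge0 (h0 _ x20) (ltW eta0)).
  rewrite -/(q x2) qx2 ltr_pdivrMr// => /ltW/le_trans; apply.
  have JK : (J < K)%N.
    rewrite ltnS -qx2; apply: le_truncn; rewrite ler_pM2r ?invr_gt0//.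
    by have /andP[] := h0N _ x20.
  rewrite /staircase (bigID (fun j : 'I_K => (j < J.+1)%N))/=.
  rewrite -[leLHS]addr0 lerD//; last by apply: sumr_ge0 => j _; rewrite mulr_ge0// ltW.
  rewrite -(big_ord_widen K (fun j => eta * (x <= d j)%R%:R))//.
  rewrite mulr_natl (_ : eta *+ J.+1 = \sum_(j < J.+1) eta); last first.
    by rewrite sumr_const card_ord.
  apply: ler_sum => j _.
  by rewrite (le_trans xd) ?mulr1// d_ni// -ltnS.
(* Without layer 0, which costs at most [e], the layers [j.+1] integrate a lower sum of [h]. *)
- rewrite int0oo_staircase ?(ltW eta0)// /K big_ord_recl addeC EFinD leeD//.
    rewrite lee_fin (@le_trans _ _ (eta * M)) ?ler_pM2l//.
    by rewrite /eta mulrAC ler_pdivrMr ?ltr_wpDl// ler_pM2l// lerDl.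
  rewrite -sumEFin.
  pose F (j : 'I_(Num.truncn (N / eta))) x : \bar R := (eta%:E * (\1_(D j.+1) x)%:E)%E.
  have mI j : measurable_fun (`[0, +oo[ : set R) (fun x => (\1_(D j) x)%:E : \bar R).
    by apply/measurable_EFinP; exact: measurable_indic.
  have mF j : measurable_fun (`[0, +oo[ : set R) (F j).
    by apply: measurable_funeM; exact: mI.
  have F0 j x : (0 <= F j x)%E by rewrite /F mule_ge0 ?lee_fin// ltW.
  rewrite (eq_bigr (fun j =>
      \int[lebesgue_measure]_(x in `[0%R, +oo[) F j x)%E); last first.
    move=> j _; rewrite /F ge0_integralZl_EFin ?(ltW eta0)//; last first.
      exact: mI.
    rewrite EFinM dE integral_indic//; last exact: mD.
    congr (_ * lebesgue_measure _)%E.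
    apply/esym/setIidl => x [/= + _]; rewrite !in_itv/= andbT.
    by case/andP.
  rewrite -(ge0_integral_sum (@lebesgue_measure R) (D := `[0%R, +oo[%classic) _ (f := F))//.
  apply: ge0_le_integral => //.
  + by move=> x _; apply: sume_ge0.
  + by apply: emeasurable_sum => j; exact: mF.
  + exact/measurable_EFinP.
  + move=> x /=; rewrite in_itv/= andbT => x0.
    apply: le_trans (_ : _ <= (\sum_(j < Num.truncn (N / eta))
        eta * (j.+1%:R * eta <= h x)%R%:R)%:E)%E _; last first.
      by rewrite lee_fin lower_sum_le ?h0// ltW.
    rewrite -sumEFin; apply: lee_sum => j _; rewrite /F -EFinM.
    rewrite lee_fin ler_wpM2l ?(ltW eta0)// indicE ler_nat.
    by case: (boolP (x \in D _)) => //; rewrite inE => -[_ /= ->].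
Qed.

(** * Measurability and sections of compact sets *)

Lemma admissible_measurable (R : realType) (f : R -> R) :
  admissible f -> measurable_fun (`[0, +oo[ : set R) f.
Proof.
move=> [_ fni _ _].
have mg : measurable_fun (`[0, +oo[ : set R) (fun x => f (Num.max 0 x)).
  apply: nonincreasing_measurable => // x y xy.
  apply: fni; first by rewrite le_max lexx.
  by rewrite ge_max !le_max lexx/= xy orbT.
apply: eq_measurable_fun mg => x; rewrite inE/= in_itv/= andbT => x0.
by rewrite max_r.
Qed.

(** An open set is the countable union of the rational boxes inside it; [F] replaces boxes that
    stick out by the empty set, so that all quadruples of rationals can index the union. *)
Lemma open_measurable2 (R : realType) (O : set (R * R)) : open O ->
  measurable (O : set (measurableTypeR R * measurableTypeR R)).
Proof.
move=> oO.
pose B (a b c d : rat) : set (measurableTypeR R * measurableTypeR R) :=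
  (`]ratr a, ratr b[ : set R) `*` (`]ratr c, ratr d[ : set R).
pose F a b c d := [set p | B a b c d `<=` O /\ B a b c d p].
have mF a b c d : measurable (F a b c d).
  have [BO|nBO] := pselect (B a b c d `<=` O).
    rewrite (_ : F a b c d = B a b c d); last by apply/seteqP; split=> [p []|p].
    by apply: measurableX.
  by rewrite (_ : F a b c d = set0)//; apply/seteqP; split=> [p []|p].
rewrite (_ : (O : set (measurableTypeR R * measurableTypeR R)) =
    \bigcup_a \bigcup_b \bigcup_c \bigcup_d F a b c d); last first.
  apply/seteqP; split=> [[x y] Oxy|[x y] [a _ [b _ [c _ [d _ []]]]]]; last by apply.
  have /nbhs_ballP[e /= e0 eO] := open_nbhs_nbhs (conj oO Oxy).
  have rat_lt (s t : R) : s < t -> exists2 q, s < ratr q & ratr q < t.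
    by move=> /rat_in_itvoo[q]; rewrite in_itv/= => /andP[]; exists q.
  have [a xa ax] := rat_lt (x - e) x ltac:(by rewrite ltrBlDr ltrDl).
  have [b xb bx] := rat_lt x (x + e) ltac:(by rewrite ltrDl).
  have [c yc cy] := rat_lt (y - e) y ltac:(by rewrite ltrBlDr ltrDl).
  have [d yd dy] := rat_lt y (y + e) ltac:(by rewrite ltrDl).
  exists a => //; exists b => //; exists c => //; exists d => //; split.
    move=> [x' y'] []; rewrite /= !in_itv/= => /andP[ax' x'b] /andP[cy' y'd].
    by apply: eO; split=> /=; rewrite /ball/= ltr_distlC; apply/andP; split; lra.
  by split; rewrite /= in_itv/= ?ax ?cy.
by do 4 (apply: bigcupT_measurable_rat => ?); exact: mF.
Qed.

Lemma compact_measurable2 (R : realType) (A : set (R * R)) : compact A ->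
  measurable (A : set (measurableTypeR R * measurableTypeR R)).
Proof.
move=> /(compact_closed (@norm_hausdorff _ _)) /closed_openC /open_measurable2.
by move=> /measurableC; rewrite setCK.
Qed.

Lemma row_ysection (R : realType) (A : set (R * R)) (u v : R) :
  row (u, v) A = lebesgue_measure (ysection A v).
Proof.
by congr lebesgue_measure; apply/seteqP; split=> x; rewrite /ysection/= inE.
Qed.

Lemma col_xsection (R : realType) (A : set (R * R)) (u v : R) :
  col (u, v) A = lebesgue_measure (xsection A u).
Proof.
by congr lebesgue_measure; apply/seteqP; split=> x; rewrite /xsection/= inE.
Qed.

Lemma measurable_row (R : realType) (A : set (R * R)) : compact A ->
  measurable_fun [set: R] (fun v => row (0, v) A).
Proof.
move=> /compact_measurable2 mA; under eq_fun do rewrite row_ysection.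
exact: (measurable_fun_ysection (@lebesgue_measure R) mA).
Qed.

Lemma measurable_col (R : realType) (A : set (R * R)) : compact A ->
  measurable_fun [set: R] (fun u => col (u, 0) A).
Proof.
move=> /compact_measurable2 mA; under eq_fun do rewrite col_xsection.
exact: (measurable_fun_xsection (@lebesgue_measure R) mA).
Qed.

Lemma integral_col_le (R : realType) (A : set (R * R)) : compact A ->
  (\int[@lebesgue_measure R]_(u in `[0%R, +oo[) col (u, 0%R) A <= area A)%E.
Proof.
move=> cA.
apply: (@le_trans _ _ (\int[@lebesgue_measure R]_u col (u, 0%R) A)%E).
  by apply: ge0_subset_integral => //; exact: measurable_col.
by rewrite /area /product_measure1; under eq_integral do rewrite col_xsection.
Qed.

Lemma integral_row_le (R : realType) (A : set (R * R)) : compact A ->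
  (\int[@lebesgue_measure R]_(v in `[0%R, +oo[) row (0%R, v) A <= area A)%E.
Proof.
move=> cA; have mA := compact_measurable2 cA.
apply: (@le_trans _ _ (\int[@lebesgue_measure R]_u row (0%R, u) A)%E).
  by apply: ge0_subset_integral => //; exact: measurable_row.
(* [area] integrates vertical sections; uniqueness of the product measure exchanges the order. *)
rewrite /area (product_measure_unique (m' := (lebesgue_measure \x^ lebesgue_measure)%E))//.
  by rewrite /product_measure2/=; under eq_integral do rewrite row_ysection.
by move=> X Y mX mY; exact: product_measure2E.
Qed.

(** * Trading a compact set for enhancements *)

Lemma dominating_profile (R : realType) (r : R -> \bar R) (f : R -> R)
    (M e : R) (a : \bar R) :
  0 < e -> 0 <= M -> admissible f -> measurable_fun [set: R] r ->
  (forall x, (0 <= r x <= M%:E)%E) -> (forall x, M < x -> r x = 0%E) ->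
  (\int[@lebesgue_measure R]_(x in `[0%R, +oo[) r x <= a)%E ->
  exists h, [/\ admissible h, dominates h (fun x => fine (r x) + f x) &
    (int0oo h <= a + int0oo f + e%:E)%E].
Proof.
move=> e0 M0 af mr r0M rM ra; have [f0 fni _ [Mf fMf]] := af.
have rfin x : r x \is a fin_num.
  by have /andP[r0 rx] := r0M x; rewrite ge0_fin_numE// (le_lt_trans rx)// ltry.
have rE x : (fine (r x))%:E = r x by rewrite fineK.
have mf := admissible_measurable af.
(* Beyond [Num.max M Mf] both summands vanish, and [f x <= f 0] gives the height bound. *)
have [||||h [ah dh ih]] := @dominating_staircase R (fun x => fine (r x) + f x)
    (Num.max M Mf) (M + f 0) e e0.
- by rewrite le_max M0.
- apply: measurable_funD => //; apply: measurable_funTS.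
  exact: (measurableT_comp (fine_measurable _)).
- move=> x x0; have /andP[r0 rx] := r0M x.
  by rewrite addr_ge0 ?fine_ge0 ?f0//= lerD ?fni// -lee_fin rE.
- by move=> x; rewrite gt_max => /andP[/rM-> /ltW/fMf->]; rewrite /= addr0.
exists h; split=> //; apply: (le_trans ih); rewrite leeD2r//.
rewrite {1}/int0oo; under eq_integral do rewrite EFinD rE.
rewrite ge0_integralD//; last 4 first.
- by move=> x _; case/andP: (r0M x).
- exact: measurable_funTS.
- by move=> x; rewrite /= in_itv/= andbT lee_fin; exact: f0.
- exact/measurable_EFinP.
by rewrite leeD2r.
Qed.

Lemma compact_sub_square (R : realType) (A : set (R * R)) : compact A ->
  exists2 M, 0 <= M & forall p, A p -> `|p.1| <= M /\ `|p.2| <= M.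
Proof.
move=> /compact_bounded[M [_ AM]]; exists (`|M| + 1); first by rewrite addr_ge0.
move=> p Ap; have MM : M < `|M| + 1 by rewrite (le_lt_trans (ler_norm M)) ?ltrDl.
have : `|p| <= `|M| + 1 := AM _ MM p Ap.
by rewrite prod_normE ge_max => /andP[].
Qed.

(** The area enters once through the row measures added to [f] and once through the column measures
    added to [g]. *)
Lemma gamma_thin_bdd_le (R : realType) (Z A : set (R * R)) f g :
  down_closed Z -> compact A -> A `<=` @quadrant R ->
  admissible f -> admissible g -> E_spans Z f g A ->
  (gamma_thin_bdd Z <= (area A + int0oo f) + (area A + int0oo g))%E.
Proof.
move=> dZ cA Aq af ag spA.
have [M M0 AM] := compact_sub_square cA.
have secM (B : set R) : (forall x, B x -> 0 <= x <= M) ->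
    (0 <= lebesgue_measure B <= M%:E)%E.
  move=> BM; rewrite measure_ge0/= -(lebesgue_measure_itv0 M0).
  by apply: le_lebesgue => x /BM; rewrite /= in_itv.
have rowM v : (0 <= row (0%R, v) A <= M%:E)%E.
  apply: secM => x Ax; have [/= x0 _] := Aq _ Ax; rewrite x0/=.
  by have [/= xM _] := AM _ Ax; apply: le_trans (ler_norm x) xM.
have colM u : (0 <= col (u, 0%R) A <= M%:E)%E.
  apply: secM => x Ax; have [/= _ x0] := Aq _ Ax; rewrite x0/=.
  by have [/= _ xM] := AM _ Ax; apply: le_trans (ler_norm x) xM.
have row0 v : M < v -> row (0%R, v) A = 0%E.
  move=> Mv; rewrite /Defs.row/= (_ : [set x | A (x, v)] = set0) ?measure0//.
  apply/seteqP; split=> // x Ax; have [/= _ vM] := AM _ Ax.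
  by have := le_lt_trans (le_trans (ler_norm _) vM) Mv; rewrite ltxx.
have col0 u : M < u -> col (u, 0%R) A = 0%E.
  move=> Mu; rewrite /Defs.col/= (_ : [set x | A (u, x)] = set0) ?measure0//.
  apply/seteqP; split=> // x Ax; have [/= uM _] := AM _ Ax.
  by have := le_lt_trans (le_trans (ler_norm _) uM) Mu; rewrite ltxx.
apply/lee_addgt0Pr => e e0; have e20 : 0 < e / 2 by rewrite divr_gt0.
have [f' [af' df' if']] := dominating_profile e20 M0 af (measurable_row cA)
  rowM row0 (integral_row_le cA).
have [g' [ag' dg' ig']] := dominating_profile e20 M0 ag (measurable_col cA)
  colM col0 (integral_col_le cA).
have [f0 _ _ [Mf fMf]] := af; have [g0 _ _ [Mg gMg]] := ag.
have [f'0 _ _ _] := af'; have [g'0 _ _ _] := ag'.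
apply: (@le_trans _ _ (int0oo f' + int0oo g')%E).
  apply: ereal_inf_lbound; exists f', g'; split=> //.
  (* The point [(w, w)] lies outside [A] and past the supports, so both profiles vanish there. *)
  pose w := Num.max M (Num.max Mf Mg) + 1.
  have Mw : M < w by rewrite ltr_pwDr// le_max lexx.
  have Mfw : Mf <= w by rewrite ler_wpDr// !le_max lexx orbT.
  have Mgw : Mg <= w by rewrite ler_wpDr// !le_max lexx !orbT.
  have w0 : 0 <= w := le_trans M0 (ltW Mw).
  apply: (E_spans_rearrange (p := (w, w)) dZ Aq spA f0 g0 _ _ f'0 g'0 df' dg') => //=.
  - move=> u v v0; rewrite EFinD fineK// ge0_fin_numE; case/andP: (rowM v) => //.
    by move=> _ /le_lt_trans; apply; rewrite ltry.
  - move=> u v u0; rewrite EFinD fineK// ge0_fin_numE; case/andP: (colM u) => //.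
    by move=> _ /le_lt_trans; apply; rewrite ltry.
  - by move=> Aww; have [/= wM _] := AM _ Aww;
      have := le_lt_trans (le_trans (ler_norm _) wM) Mw; rewrite ltxx.
  - by rewrite row0// fMf// addr0.
  - by rewrite col0// gMg// addr0.
apply: (le_trans (leeD if' ig')).
by rewrite {3}(splitr e) EFinD addeACA.
Qed.

(** * Truncated values and their limits *)

Lemma int0oo_ge0 (R : realType) (f : R -> R) : admissible f -> (0 <= int0oo f)%E.
Proof.
by move=> [f0 _ _ _]; apply: integral_ge0 => x; rewrite /= in_itv/= andbT => /f0.
Qed.

Lemma area_ge0 (R : realType) (A : set (R * R)) : (0 <= area A)%E.
Proof. exact: measure_ge0. Qed.

Lemma I_bdd_ge0 (R : realType) (al : R) (Z : set (R * R)) :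
  al <= 1 -> (0 <= I_bdd al al Z)%E.
Proof.
rewrite -subr_ge0 => al1; apply: le_ereal_inf_tmp => _ [A [f [g [_ af ag _ ->]]]].
apply: adde_ge0; [apply: adde_ge0; first exact: area_ge0|];
  by apply: mule_ge0; rewrite ?lee_fin ?int0oo_ge0.
Qed.

Lemma gamma_thin_bdd_ge0 (R : realType) (Z : set (R * R)) : (0 <= gamma_thin_bdd Z)%E.
Proof.
apply: le_ereal_inf_tmp => _ [f [g [af ag _ ->]]].
by rewrite adde_ge0 ?int0oo_ge0.
Qed.

Lemma subset_rect (R : realType) (r s : R) : r <= s -> rect r r `<=` rect s s.
Proof.
by move=> rs p [/andP[p0 pr] /andP[q0 qr]]; split; apply/andP; split=> //;
  exact: le_trans rs.
Qed.

(** By [E_spans_le] a larger truncation admits fewer spanning triples, so the infimum is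
    nondecreasing in [r] and its limit is a supremum. *)
Lemma I_tildeE (R : realType) (al be : R) (Z : set (R * R)) : down_closed Z ->
  I_tilde al be Z = ereal_sup (range (fun r => I_bdd al be (Z `&` rect r r))).
Proof.
move=> dZ; apply: cvg_lim => //; apply: nondecreasing_cvge => r s rs.
apply: le_ereal_inf_tmp => _ [A [f [g [[cA Aq] af ag sp ->]]]].
apply: ereal_inf_lbound; exists A, f, g; split=> //.
apply: E_spans_le sp => //; first exact: down_closedI_rect.
by apply: setIS; exact: subset_rect.
Qed.

Lemma gamma_thinE (R : realType) (Z : set (R * R)) : down_closed Z ->
  gamma_thin Z = ereal_sup (range (fun r => gamma_thin_bdd (Z `&` rect r r))).
Proof.
move=> dZ; apply: cvg_lim => //; apply: nondecreasing_cvge => r s rs.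
apply: le_ereal_inf_tmp => _ [f [g [af ag sp ->]]].
apply: ereal_inf_lbound; exists f, g; split=> //.
apply: E_spans_le sp => //; first exact: down_closedI_rect.
by apply: setIS; exact: subset_rect.
Qed.

Lemma le_ereal_sup_range (R : realType) (F : R -> \bar R) r :
  (F r <= ereal_sup (range F))%E.
Proof. by apply: ereal_sup_ubound; exists r. Qed.

Lemma I_tilde_ge0 (R : realType) (al : R) (Z : set (R * R)) : down_closed Z ->
  al <= 1 -> (0 <= I_tilde al al Z)%E.
Proof.
move=> dZ al1; rewrite I_tildeE//.
exact: le_trans (I_bdd_ge0 _ al1) (le_ereal_sup_range _ 0).
Qed.

Lemma gamma_thin_ge0 (R : realType) (Z : set (R * R)) : down_closed Z ->
  (0 <= gamma_thin Z)%E.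
Proof.
move=> dZ; rewrite gamma_thinE//.
exact: le_trans (gamma_thin_bdd_ge0 _) (le_ereal_sup_range _ 0).
Qed.

(** Take height [L > r] on [[0, L]]. One step fills a vertical strip of width [L]; every row then
    has measure at least [L], so the second step fills the quadrant. *)
Lemma bounded_thin_spans (R : realType) (Z : set (R * R)) (r : R) :
  exists2 f, admissible f & E_spans (Z `&` rect r r) f f set0.
Proof.
pose L := `|r| + 1; have L0 : 0 <= L by rewrite addr_ge0.
have rL : r < L by rewrite (le_lt_trans (ler_norm r)) ?ltrDl.
pose f := staircase L (fun=> L) 1.
have af : admissible f by apply: (staircase_admissible (M := L)).
have [f0 _ _ _] := af.
have fL x : x <= L -> f x = L by move=> xL; rewrite /f /staircase big_ord1 xL mulr1.
have fst_le a b : inZ (Z `&` rect r r) a b -> (a <= r%:E)%E.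
  by move=> [x [y [-> _ [_ [/= /andP[_ ? _]]]]]]; rewrite lee_fin.
have snd_le a b : inZ (Z `&` rect r r) a b -> (b <= r%:E)%E.
  by move=> [x [y [_ -> [_ [/= _ /andP[_ ?]]]]]]; rewrite lee_fin.
exists f => //; apply/seteqP; split.
  by move=> p [n _]; exact: iter_T_op_quadrant.
move=> p [u0 v0]; exists 2%N => //; right; split=> // /fst_le.
rewrite leNgt => /negP; apply; rewrite -lte_fin in rL.
apply: (lt_le_trans rL); rewrite -[leLHS]adde0 leeD ?lee_fin ?f0//.
rewrite -(lebesgue_measure_itv0 L0); apply: le_lebesgue => x.
rewrite /= in_itv/= => /andP[x0 xL]; right; split=> // /snd_le.
rewrite leNgt => /negP; apply; apply: (lt_le_trans rL).
by rewrite /= fL// -[leLHS]add0e leeD2r// col_ge0.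
Qed.

(** * Inequalities between the three constants *)

Lemma I_tilde_le (R : realType) (al : R) (Z : set (R * R)) : down_closed Z ->
  al <= 1 -> (I_tilde al al Z <= gamma_thin Z * (1 - al)%:E)%E.
Proof.
move=> dZ; rewrite -subr_ge0 => al1.
have le_thin r f g : admissible f -> admissible g ->
    E_spans (Z `&` rect r r) f g set0 ->
    (I_bdd al al (Z `&` rect r r) <= (int0oo f + int0oo g) * (1 - al)%:E)%E.
  move=> af ag sp; apply: ereal_inf_lbound; exists set0, f, g; split=> //.
    by split; [exact: compact0|exact: sub0set].
  by rewrite /area measure0 add0e !(muleC (1 - al)%:E) ge0_muleDl ?int0oo_ge0.
rewrite I_tildeE//; apply: ge_ereal_sup => _ [r _ <-].
(* At weight 0 one cannot divide, but any spanning pair started from the empty set has cost 0. *)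
have /predU1P[al1'|al1'] : (0 == 1 - al) || (0 < 1 - al) by rewrite -le_eqVlt.
  have [f af sp] := bounded_thin_spans Z r.
  by rewrite (le_trans (le_thin _ _ _ af af sp))// -al1' !mule0.
apply: (@le_trans _ _ (gamma_thin_bdd (Z `&` rect r r) * (1 - al)%:E)%E).
  rewrite -lee_pdivrMr//; apply: le_ereal_inf_tmp => _ [f [g [af ag sp ->]]].
  by rewrite lee_pdivrMr// le_thin.
rewrite lee_wpmul2r ?lee_fin ?al1// gamma_thinE//.
exact: (le_ereal_sup_range (fun r => gamma_thin_bdd (Z `&` rect r r))).
Qed.

Lemma twice_area_le (R : realType) (a F G : \bar R) (d : R) :
  (0 <= a)%E -> (0 <= F)%E -> (0 <= G)%E -> 0 <= d <= 2^-1 ->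
  (((a + F) + (a + G)) * d%:E <= a + d%:E * F + d%:E * G)%E.
Proof.
move=> a0 F0 G0 /andP[d0 d2].
rewrite addeACA [in leLHS]muleC ge0_muleDr ?adde_ge0// [X in (_ + X <= _)%E]ge0_muleDr//.
rewrite -[leRHS]addeA leeD2r// ge0_muleDr// -ge0_muleDl ?lee_fin//.
by rewrite -[leRHS]mul1e lee_wpmul2r// -EFinD lee_fin; lra.
Qed.

Lemma weighted_le (R : realType) (a F G : \bar R) (d : R) :
  (0 <= a)%E -> (0 <= F)%E -> (0 <= G)%E -> 0 <= d <= 1 ->
  ((a + F + G) * d%:E <= a + d%:E * F + d%:E * G)%E.
Proof.
move=> a0 F0 G0 /andP[d0 d1].
rewrite [in leLHS]muleC !ge0_muleDr ?adde_ge0// !leeD2r//.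
by rewrite -[leRHS]mul1e lee_wpmul2r// lee_fin.
Qed.

(* For [1 - al <= 1/2], charging the area twice with weight [1 - al] costs at
   most the area itself. *)
Lemma gamma_thin_le (R : realType) (al : R) (Z : set (R * R)) : down_closed Z ->
  2^-1 <= al < 1 -> (gamma_thin Z * (1 - al)%:E <= I_tilde al al Z)%E.
Proof.
move=> dZ /andP[al2 al1]; have d0 : 0 < 1 - al by rewrite subr_gt0.
rewrite -lee_pdivlMr// gamma_thinE//; apply: ge_ereal_sup => _ [r _ <-].
rewrite lee_pdivlMr// I_tildeE//.
apply: le_trans (le_ereal_sup_range (fun r => I_bdd al al (Z `&` rect r r)) r).
apply: le_ereal_inf_tmp => _ [A [f [g [[cA Aq] af ag sp ->]]]].
have := gamma_thin_bdd_le (down_closedI_rect (r := r) dZ) cA Aq af ag sp.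
rewrite -(lee_pmul2r (x := (1 - al)%:E))// => /le_trans; apply.
by apply: twice_area_le; rewrite ?area_ge0 ?int0oo_ge0//; lra.
Qed.

(** The same triples compete on both sides, and scaling the cost at weight 1 by [1 - al <= 1] only
    lowers the area term. *)
Lemma gamma_tilde_le (R : realType) (al : R) (Z : set (R * R)) : down_closed Z ->
  0 <= al <= 1 -> ((1 - al)%:E * gamma_tilde Z <= I_tilde al al Z)%E.
Proof.
move=> dZ /andP[al0]; rewrite le_eqVlt => /predU1P[->|al1].
  by rewrite subrr mul0e I_tilde_ge0.
have d0 : 0 < 1 - al by rewrite subr_gt0.
rewrite muleC -lee_pdivlMr// /gamma_tilde !I_tildeE//.
apply: ge_ereal_sup => _ [r _ <-]; rewrite lee_pdivlMr//.
apply: le_trans (le_ereal_sup_range (fun r => I_bdd al al (Z `&` rect r r)) r).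
apply: le_ereal_inf_tmp => _ [A [f [g [[cA Aq] af ag sp ->]]]].
rewrite -lee_pdivlMr//; apply: (@le_trans _ _ (area A + int0oo f + int0oo g)%E).
  apply: ereal_inf_lbound; exists A, f, g; split=> //.
  by rewrite subr0 !mul1e.
rewrite lee_pdivlMr// weighted_le ?area_ge0 ?int0oo_ge0//.
by rewrite ltW//= gerBl.
Qed.

Theorem mainTheorem19 (R : realType) (Z : set (R * R)) :
  euclidean_zero_set Z -> (area Z < +oo)%E ->
  (forall alpha : R, 0 <= alpha <= 1 ->
     (gamma_thin Z * ((1 - alpha) - 2 * (1 - alpha) ^+ 2)%:E
        <= I_tilde alpha alpha Z)%E /\
     (I_tilde alpha alpha Z <= gamma_thin Z * (1 - alpha)%:E)%E) /\
  ((forall alpha : R, 0 <= alpha <= 1 ->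
      I_tilde alpha alpha Z = ((1 - alpha)%:E * gamma_tilde Z)%E)
   <-> gamma_thin Z = gamma_tilde Z).
Proof.
(* The factor equals [(1 - al) * (2 * al - 1)], so below one half the lower bound is nonpositive. *)
have low (al : R) : al < 2^-1 -> 1 - al - 2 * (1 - al) ^+ 2 <= 0 by nra.
have half : 0 <= (2^-1 : R) <= 1 by lra.
have half0 : (0 : R) < 1 - 2^-1 by lra.
have half1 : (2^-1 : R) <= (2^-1 : R) < 1 by lra.
move=> [_ _ dZ _] _; have G0 := gamma_thin_ge0 dZ.
split=> [al /andP[al0 al1]|].
  split; last exact: I_tilde_le.
  have [al2|al2] := ltP al 2^-1.
    apply: le_trans (I_tilde_ge0 dZ al1).
    by rewrite mule_ge0_le0// lee_fin low.
  have /predU1P[al1'|al1'] : (al == 1) || (al < 1) by rewrite -le_eqVlt.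
    by rewrite al1' subrr expr0n mulr0 subr0 mule0 I_tilde_ge0.
  apply: (@le_trans _ _ (gamma_thin Z * (1 - al)%:E)%E).
    by rewrite lee_wpmul2l// lee_fin gerBl mulr_ge0 ?sqr_ge0.
  by apply: gamma_thin_le => //; rewrite al2.
split=> [Ilin|thinE al /andP[al0 al1]].
  (* One inequality is [I_tilde_le] at weight parameter 0; the other is [gamma_thin_le] at one half,
     where linearity evaluates [I_tilde]. *)
  apply/eqP; rewrite eq_le; apply/andP; split; last first.
    by have := I_tilde_le dZ (@ler01 R); rewrite subr0 mule1.
  rewrite -(lee_pmul2r (x := (1 - 2^-1)%:E))// [leRHS]muleC -Ilin//.
  exact: gamma_thin_le.
(* The bounds [gamma_tilde_le] and [I_tilde_le] coincide under [thinE]. *)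
apply/eqP; rewrite eq_le gamma_tilde_le ?al0 ?al1// andbT.
by rewrite muleC -thinE I_tilde_le.
Qed.
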